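(* Let $G$ be a group acting geometrically by automorphisms on a weakly systolic $SD_2^{\ast}(7)$ complex $X$. Then any quasi-convex subgroup $H$ of $G$ is convex cocompact, i.e. there exists a convex $H$-invariant subcomplex $Y$ of $X$ on which $H$ acts geometrically. In particular $H$ acts geometrically on a weakly systolic $SD_2^{\ast}(7)$ complex.
   Context: Conventions: $X$ is connected; simplices are finite. A geometric action is properly discontinuous and cocompact. $d$ is the path metric of the $1$-skeleton on vertices. $X$ is flag if every finite set of pairwise adjacent vertices spans a simplex. The link $X_\sigma$ of a simplex $\sigma$ is the subcomplex of simplices $\tau$ disjoint from $\sigma$ with $\tau\cup\sigma$ spanning a simplex. $B_i(v)=B_i(v,X)$ (resp. $S_i(v)$) is the full subcomplex spanned by vertices at distance at most $i$ (resp. exactly $i$) from $v$. A subcomplex is full if every set of its vertices contained in a simplex of $X$ is contained in a simplex of the subcomplex. Weakly systolic: $X$ is flag and for every vertex $v$ and every $i\ge1$: (E) for every edge $e\in S_{i+1}(v)$, $X_e\cap B_i(v)\ne\emptyset$; (V) for every vertex $w\in S_{i+1}(v)$, $X_w\cap B_i(v)$ is a single simplex. Wheels: for $k\ge4$ a $k$-wheel $(v_0;v_1,\dots,v_k)$ is a full subcomplex such that $(v_1,\dots,v_k,v_1)$ is a full $k$-cycle (distinct vertices, cyclically consecutive ones adjacent, no other adjacencies among them) and $v_0$ is adjacent to all $v_1,\dots,v_k$. A $k$-wheel with a pendant triangle is the union of a $k$-wheel and a triangle $\langle v_1,v_2,t\rangle$ of $X$ with $t\neq v_i$ for $i=0,\dots,k$.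 $X$ is an $SD_2^{\ast}(k)$ complex ($k\ge5$) if it is flag, has no $4$-wheels, and for $5\le l<k$ every $l$-wheel with a pendant triangle $\widehat W$ in $X$ is contained in $B_1(v,X)$ for some vertex $v$. (A group $G$ as in the claim is Gromov hyperbolic.) A subcomplex $Z$ of $X$ is convex if it is full, connected, and contains every $1$-skeleton geodesic of $X$ joining two of its vertices. A subcomplex $Y$ of a connected simplicial complex (in particular a set of vertices of a graph) is $K$-quasi-convex if for every geodesic $(v_0,\dots,v_n)$ in the $1$-skeleton with $v_0,v_n\in Y$ one has $d(v_i,Y)\le K$ for all $i$; it is quasi-convex if it is $K$-quasi-convex for some $K>0$. A subgroup $H$ of a Gromov hyperbolic group $G$ is quasi-convex if $H$ is a quasi-convex subset of the Cayley graph $C(G,S)$ for some finite generating set $S$ of $G$. *)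

(* Defs.v *)
From HB Require Import structures.
From mathcomp Require Import all_boot.
From mathcomp Require Import all_classical.

Set Implicit Arguments.
Unset Strict Implicit.
Unset Printing Implicit Defensive.

Local Open Scope classical_set_scope.

(* Graphs are given by their adjacency relation.  An edge path
   (v_0, v_1, ..., v_n) is represented, as in path.v, by x = v_0 and
   p = [:: v_1; ...; v_n], so that its length is [size p]. *)

Definition dist_le (T : Type) (e : rel T) (n : nat) (u v : T) : Prop :=
  exists p : seq T, [/\ path e u p, last u p = v & size p <= n].

Definition dist_eq (T : Type) (e : rel T) (n : nat) (u v : T) : Prop :=
  dist_le e n u v /\ forall m, dist_le e m u v -> n <= m.

Definition geodesic (T : Type) (e : rel T) (x : T) (p : seq T) : Prop :=
  path e x p /\ dist_eq e (size p) x (last x p).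

(* Distances are integers, so a natural constant K loses no generality. *)
Definition quasiconvex (T : Type) (e : rel T) (Y : set T) : Prop :=
  exists2 K : nat, 0 < K &
    forall x p, geodesic e x p -> Y x -> Y (last x p) ->
    forall i, i <= size p ->
      exists2 y, Y y & dist_le e K (nth x (x :: p) i) y.

(* Only nonempty simplices are recorded, and a point of V need not be a vertex;
   thus subcomplexes, links and balls live on the same V, and an intersection
   of complexes is empty iff it is the empty set of simplices. *)
Record complex (V : Type) := Complex {
  simplex :> set V -> Prop;
  simplex_finite : forall s, simplex s -> finite_set s;
  simplex_neq0 : forall s, simplex s -> s !=set0;
  simplex_face : forall s t, simplex s -> t `<=` s -> t !=set0 -> simplex t
}.

Section Complexes.
Variables (V : Type) (X : complex V).

Definition vertices : set V := [set v | X [set v]].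

Definition adj : rel V := fun u v => `[< u <> v /\ X [set u; v] >].

Definition connected_complex : Prop :=
  vertices !=set0 /\
  forall u v, vertices u -> vertices v -> exists n, dist_le adj n u v.

Definition flag : Prop :=
  forall A : set V, finite_set A -> A !=set0 -> A `<=` vertices ->
    (forall u v, A u -> A v -> u <> v -> adj u v) -> X A.

Definition link (s : set V) : set (set V) :=
  [set t | [/\ X t, t `&` s = set0 & X (t `|` s)]].

Definition span (A : set V) : set (set V) := [set s | X s /\ s `<=` A].

Definition ball (v : V) (i : nat) : set (set V) :=
  span [set w | dist_le adj i v w].

Definition sphere (v : V) (i : nat) : set (set V) :=
  span [set w | dist_eq adj i v w].

Definition faces (s : set V) : set (set V) :=
  [set t | t !=set0 /\ t `<=` s].

Definition weakly_systolic : Prop :=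
  [/\ connected_complex,
      flag &
      forall v i, vertices v -> 1 <= i ->
        (forall a b, a <> b -> sphere v i.+1 [set a; b] ->
           (link [set a; b] `&` ball v i) !=set0) /\
        (forall w, sphere v i.+1 [set w] ->
           exists2 s, X s & link [set w] `&` ball v i = faces s)].

(* The wheel (v_0; v_1, ..., v_k) is encoded by v : nat -> V, whose values
   beyond k are irrelevant. *)
Definition wheel (k : nat) (v : nat -> V) : Prop :=
  [/\ 4 <= k,
      forall i j, 1 <= i -> i < j -> j <= k -> v i <> v j,
      forall i j, 1 <= i -> i < j -> j <= k ->
        adj (v i) (v j) <-> (j = i.+1 \/ (i = 1 /\ j = k)) &
      forall i, 1 <= i <= k -> adj (v 0) (v i)].

Definition pendant_triangle (k : nat) (v : nat -> V) (t : V) : Prop :=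
  [/\ X [set v 1; v 2; t] & forall i, i <= k -> t <> v i].

Definition wheel_with_pendant (k : nat) (v : nat -> V) (t : V) : set (set V) :=
  span [set v i | i in [set i | i <= k]] `|` faces [set v 1; v 2; t].

Definition SD2star (k : nat) : Prop :=
  [/\ 5 <= k,
      flag,
      forall v, ~ wheel 4 v &
      forall l v t, 5 <= l -> l < k -> wheel l v -> pendant_triangle l v t ->
        exists2 u, vertices u & wheel_with_pendant l v t `<=` ball u 1].

End Complexes.

Section Subcomplexes.
Variables (V : Type) (X Y : complex V).

Definition full_subcomplex : Prop :=
  simplex Y `<=` simplex X /\
  forall A : set V, A `<=` vertices Y ->
    (exists2 s, X s & A `<=` s) -> exists2 t, Y t & A `<=` t.

(* It suffices to ask for the vertices of geodesics: their edges then belong to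
   Y by fullness. *)
Definition convex_subcomplex : Prop :=
  [/\ full_subcomplex,
      connected_complex Y &
      forall x p, geodesic (adj X) x p -> vertices Y x -> vertices Y (last x p) ->
        forall i, i <= size p -> vertices Y (nth x (x :: p) i)].

End Subcomplexes.

Section Actions.
Variable G : groupType.
Local Open Scope group_scope.

Definition subgroup (H : set G) : Prop := group_closed (mem H).

(* The action of a subgroup H of G; the values of act outside H and outside the
   vertex set of X are irrelevant.  The action of G is the case H = setT. *)
Definition simplicial_action (V : Type) (H : set G) (act : G -> V -> V)
    (X : complex V) : Prop :=
  [/\ forall v, vertices X v -> act 1 v = v,
      forall g h v, H g -> H h -> vertices X v ->
        act (g * h) v = act g (act h v) &
      forall g s, H g -> X s -> X (act g @` s)].

(* A compact set lies in a finite subcomplex, and a finite subcomplex meets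
   a translate of itself iff their vertex sets meet. *)
Definition properly_discontinuous (V : Type) (H : set G) (act : G -> V -> V)
    (X : complex V) : Prop :=
  forall A : set V, finite_set A -> A `<=` vertices X ->
    finite_set [set g | H g /\ ((act g @` A) `&` A) !=set0].

Definition cocompact (V : Type) (H : set G) (act : G -> V -> V)
    (X : complex V) : Prop :=
  exists F : set (set V), [/\ finite_set F, F `<=` simplex X &
    forall s, X s -> exists g t, [/\ H g, F t & s = act g @` t]].

Definition geometric_action (V : Type) (H : set G) (act : G -> V -> V)
    (X : complex V) : Prop :=
  [/\ simplicial_action H act X,
      properly_discontinuous H act X &
      cocompact H act X].

Definition invariant_subcomplex (V : Type) (H : set G) (act : G -> V -> V)
    (Y : complex V) : Prop :=
  forall g s, H g -> Y s -> Y (act g @` s).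

Definition convex_cocompact (V : Type) (H : set G) (act : G -> V -> V)
    (X : complex V) : Prop :=
  exists Y : complex V, [/\ convex_subcomplex X Y,
    invariant_subcomplex H act Y & geometric_action H act Y].

Definition generates (S : set G) : Prop := smallest subgroup S = [set: G].

Definition cayley (S : set G) : rel G :=
  fun g h => `[< g <> h /\ exists2 s, S s & h = g * s \/ g = h * s >].

Definition quasiconvex_subgroup (H : set G) : Prop :=
  subgroup H /\
  exists S : set G, [/\ finite_set S, generates S & quasiconvex (cayley S) H].

End Actions.

(* Main.v *)
Require Import Defs.
From HB Require Import structures.
From mathcomp Require Import all_boot.
From mathcomp Require Import all_classical.
From mathcomp Require Import zify.

Set Implicit Arguments.
Unset Strict Implicit.
Unset Printing Implicit Defensive.
Set Maximal Implicit Insertion.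

Local Open Scope classical_set_scope.

(** Fix a vertex v0.  For large R, the vertices within distance R of the orbit
    H v0 span a convex subcomplex Y of X: this is what is proved, and the rest
    follows from it.  Y is H-invariant and X is locally finite, so H acts
    geometrically on Y, and weak systolicity and SD2star pass from X to any
    convex subcomplex, because the vertices that these conditions ask for lie on
    geodesics between vertices of Y.

    Distances from a base vertex x cut X into levels.  Weak systolicity gives
    two facts: adjacent vertices of equal positive level have a common
    neighbour one level below ([triangle_condition]), and the lower neighbours
    of a vertex are pairwise adjacent ([children_near]).  They imply that a
    connected set of vertices is convex as soon as it is locally convex, i.e.
    distinct vertices of it with a common neighbour outside it are adjacent
    ([walk_desc_closed]).

    To see that Y is locally convex, let x be at distance R + 1 from the orbit,
    with neighbours u and v that start geodesics of length R + 1 from x to orbit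
    points q1 and q2.  As H is quasi-convex, an argument of Milnor-Svarc type
    joins q1 to q2 by a walk of length linear in R whose vertices all stay
    within a constant K of the orbit, hence outside the ball of radius R - K
    around x ([quasiconvex_orbit]).

    Negative curvature enters through [bigon_thin]: vertices of equal level on
    two geodesics with the same ends are equal or adjacent.  Push a walk down
    towards x.  Each level shortens it by one edge, so a piece of M edges
    shrinks to a point after M levels, and by thinness the points obtained from
    consecutive pieces are equal or adjacent: M levels divide the length by M
    ([walk_contract]).  The walk from q1 to q2 has linear length and about R
    levels to fall through, so choosing R large makes it collapse to a single
    vertex p of level 5 that lies on geodesics from x to both q1 and q2.

    Then u and v are adjacent ([first_steps_near]).  Otherwise three geodesics,
    from u towards q1, from v towards q2 and from x to p, form a ladder
    with rigid diagonals.  A vertex of the middle geodesic is the centre of a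
    6-wheel when the rungs at its level and at the next one are both wide, and
    of a 5-wheel when only the lower one is.  Pendant triangles formed by edges
    of the ladder make the 6-wheels impossible, and the 5-wheels too from level
    2 on, while two consecutive rungs are never both narrow; five levels leave
    no pattern of wide and narrow rungs. *)

(** * Walks *)

Section Walks.
Variables (T : Type) (e : rel T).

Definition near (a b : T) : Prop := a = b \/ e a b.

(** Steps may be stationary, so a walk of length at most m can be
    padded to length exactly m. *)
Fixpoint walk (P : set T) (m : nat) (u w : T) : Prop :=
  if m is m'.+1 then P u /\ exists2 v, near u v & walk P m' v w
  else P u /\ u = w.

Lemma walk_start P m u w : walk P m u w -> P u.
Proof. by case: m => [|m] []. Qed.

Lemma walk_end P m u w : walk P m u w -> P w.
Proof. by elim: m u => [|m IH] u /= [Pu]; [move=> <-|move=> [v _ /IH]]. Qed.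

Lemma walk_cat P m n u v w :
  walk P m u v -> walk P n v w -> walk P (m + n) u w.
Proof.
elim: m u => [|m IH] u /= [Pu]; first by move=> ->.
by move=> [v' uv' /IH h] /h; split=> //; exists v'.
Qed.

Lemma walk_split P m n u w :
  walk P (m + n) u w -> exists2 v, walk P m u v & walk P n v w.
Proof.
elim: m u => [|m IH] u /=; first by move=> h; exists u => //; split=> //; apply: walk_start h.
by move=> [Pu [v uv /IH[v' h1 h2]]]; exists v' => //; split=> //; exists v.
Qed.

Lemma walk_pad P m n u w : m <= n -> walk P m u w -> walk P n u w.
Proof.
elim: m n u => [|m IH] n u /=.
  move=> _ [Pu <-]; elim: n => [|n IH] //=; split=> //.
  by exists u => //; left.
case: n => // n mn [Pu [v uv h]]; split=> //; exists v => //; exact: IH.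
Qed.

Lemma walk_sub (P Q : set T) m u w : P `<=` Q -> walk P m u w -> walk Q m u w.
Proof.
move=> PQ; elim: m u => [|m IH] u /= [/PQ Pu]; first by split.
by move=> [v uv /IH h]; split=> //; exists v.
Qed.

Lemma walk_dist P m u w : walk P m u w -> dist_le e m u w.
Proof.
elim: m u => [|m IH] u /= [Pu]; first by move=> <-; exists [::].
move=> [v [<-|uv] /IH[p [pp lp sp]]].
  by exists p; split=> //; apply: leqW.
by exists (v :: p); split=> //=; rewrite uv.
Qed.

Lemma dist_walk m u w : dist_le e m u w -> walk setT m u w.
Proof.
move=> [p [pp lp sp]]; apply: walk_pad sp _.
elim: p u pp lp => [|v p IH] u /=; first by move=> _ ->.
move=> /andP[uv pp] lp; split=> //; exists v; [by right|exact: IH].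
Qed.

Lemma dist_le0 u w : dist_le e 0 u w -> u = w.
Proof. by move=> /dist_walk[]. Qed.

Lemma dist_refl n u : dist_le e n u u.
Proof. by exists [::]. Qed.

Lemma dist_leW m n u w : m <= n -> dist_le e m u w -> dist_le e n u w.
Proof. by move=> mn [p [pp lp sp]]; exists p; split=> //; apply: leq_trans mn. Qed.

Lemma dist_trans m n u v w :
  dist_le e m u v -> dist_le e n v w -> dist_le e (m + n) u w.
Proof.
move=> /dist_walk h1 /dist_walk h2; apply: walk_dist (walk_cat h1 h2).
Qed.

Lemma near_dist u w : near u w -> dist_le e 1 u w.
Proof. by move=> h; apply: (@walk_dist setT); split=> //; exists w. Qed.

Lemma dist_near u w : dist_le e 1 u w -> near u w.
Proof. by move=> /dist_walk[_ [v uv [_ <-]]]. Qed.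

Lemma dist_split m n u w : dist_le e (m + n) u w ->
  exists2 v, dist_le e m u v & dist_le e n v w.
Proof.
by move=> /dist_walk/walk_split[v /walk_dist h1 /walk_dist h2]; exists v.
Qed.

Lemma dist_eq_exists n u w : dist_le e n u w -> exists m, dist_eq e m u w.
Proof.
move=> h.
have ex : exists n, `[< dist_le e n u w >] by exists n; apply/asboolP.
case: (ex_minnP ex) => m /asboolP hm mmin; exists m; split=> // k hk.
by apply: mmin; apply/asboolP.
Qed.

Section Sym.
Hypothesis esym : forall a b, e a b -> e b a.

Lemma near_sym a b : near a b -> near b a.
Proof. by case=> [->|/esym]; [left|right]. Qed.

Lemma walk_rev P m u w : walk P m u w -> walk P m w u.
Proof.
elim: m u => [|m IH] u /= [Pu]; first by move=> <-.
move=> [v uv /IH h]; change (walk P m.+1 w u); rewrite -addn1; apply: (walk_cat h).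
by split; [exact: walk_end h|exists u => //; exact: near_sym].
Qed.

Lemma dist_sym m u w : dist_le e m u w -> dist_le e m w u.
Proof. by move=> /dist_walk/walk_rev/walk_dist. Qed.

End Sym.

(** A point that no path reaches gets level 0, so that a positive level always
    is a distance. *)
Definition lev (x v : T) : nat := xget 0 [set n | dist_eq e n x v].

Lemma levP x v n : dist_le e n x v -> dist_eq e (lev x v) x v.
Proof.
by move=> /dist_eq_exists h; exact: (xgetPex 0 h).
Qed.

Lemma lev_le x v n : dist_le e n x v -> lev x v <= n.
Proof. by move=> h; have [_] := levP h; apply. Qed.

Lemma lev_eq x v n : dist_eq e n x v -> lev x v = n.
Proof.
move=> [h1 h2]; apply/eqP; rewrite eqn_leq lev_le //=; apply: h2.
by have [] := levP h1.
Qed.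

Lemma lev_gt0 x v : 0 < lev x v -> dist_eq e (lev x v) x v.
Proof. by rewrite /lev; case: xgetP. Qed.

Lemma lev_down x v n : lev x v = n.+1 -> exists2 w, e w v & lev x w = n.
Proof.
move=> l; have := @lev_gt0 x v; rewrite l => /(_ isT) [h hmin].
move: h; rewrite -addn1 => /dist_split[w h1 /dist_near wv].
have nv : ~ dist_le e n x v by move=> /hmin; rewrite ltnn.
case: wv => [wv|wv]; first by rewrite wv in h1.
exists w => //; apply/eqP; rewrite eqn_leq lev_le //=.
have [hw _] := levP h1; rewrite -ltnS -[(lev x w).+1]addn1; apply: hmin.
by apply: dist_trans hw _; apply: near_dist; right.
Qed.

Lemma lev_adj x a b : (exists n, dist_le e n x b) -> e b a -> lev x a <= (lev x b).+1.
Proof.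
move=> [n h] ba; apply: lev_le; rewrite -addn1; have [h1 _] := levP h.
by apply: dist_trans h1 _; apply: near_dist; right.
Qed.
End Walks.

(** * Levels in a weakly systolic complex *)

Section Adjacency.
Variables (V : Type) (X : complex V).
Notation e := (adj X).

Lemma adjP a b : adj X a b <-> a <> b /\ X [set a; b].
Proof. by split=> [/asboolP|h]; last apply/asboolP. Qed.

Lemma adj_sym a b : adj X a b -> adj X b a.
Proof. by move=> /adjP[ab h]; apply/adjP; rewrite setUC; split=> // /esym. Qed.

Lemma adj_neq a b : adj X a b -> a <> b.
Proof. by move=> /adjP[]. Qed.

Lemma simplex_vertex s a : X s -> s a -> vertices X a.
Proof. by move=> Xs sa; apply: simplex_face Xs _ _; [move=> _ ->|exists a]. Qed.

Lemma simplex_adj s a b : X s -> s a -> s b -> a <> b -> adj X a b.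
Proof.
move=> Xs sa sb ab; apply/adjP; split=> //; apply: simplex_face Xs _ _.
  by move=> _ [] ->.
by exists a; left.
Qed.

Lemma adj_vl a b : adj X a b -> vertices X a.
Proof. by move=> /adjP[_ /simplex_vertex]; apply; left. Qed.

Lemma adj_vr a b : adj X a b -> vertices X b.
Proof. by move=> /adj_sym /adj_vl. Qed.

Lemma flag_triangle a b c : flag X -> adj X a b -> adj X a c -> adj X b c ->
  X [set a; b; c].
Proof.
move=> fX ab ac bc; apply: fX.
- exact: finite_set3.
- by exists a; left; left.
- by move=> _ [[->|->]|->]; [exact: adj_vl ab|exact: adj_vr ab|exact: adj_vr bc].
- move=> u v [[->|->]|->] [[->|->]|->] // _; exact: adj_sym.
Qed.
End Adjacency.

Section Levels.
Variables (V : Type) (X : complex V).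
Hypothesis Xws : weakly_systolic X.
Notation e := (adj X).
Notation near := (near e).
Notation lev := (lev e).

Lemma vertex_dist x v : vertices X x -> vertices X v -> exists n, dist_le e n x v.
Proof. by case: Xws => [[_ h] _ _]; apply: h. Qed.

Lemma levE x v : vertices X x -> vertices X v -> dist_eq e (lev x v) x v.
Proof. by move=> xV vV; have [n h] := vertex_dist xV vV; apply: levP h. Qed.

Lemma lev0 x v : vertices X x -> vertices X v -> lev x v = 0 -> x = v.
Proof. by move=> xV vV l; have [] := levE xV vV; rewrite l => /dist_le0. Qed.

Lemma levxx x : lev x x = 0.
Proof. by apply/eqP; rewrite -leqn0; apply: lev_le; exact: dist_refl. Qed.

Lemma lev_step x a b : vertices X x -> e a b -> lev x a <= (lev x b).+1.
Proof.
move=> xV ab; apply: lev_adj (adj_sym ab); apply: vertex_dist => //.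
exact: adj_vr ab.
Qed.

Lemma lev_near x a b : vertices X x -> near a b -> lev x a <= (lev x b).+1.
Proof. by move=> xV [->|] //; exact: lev_step. Qed.

Lemma lev1 x a : vertices X x -> e x a -> lev x a = 1.
Proof.
move=> xV xa; have := lev_step xV (adj_sym xa); rewrite levxx => le1.
apply/eqP; rewrite eqn_leq le1 /= lt0n; apply/eqP => /(lev0 xV (adj_vr xa)).
exact: adj_neq xa.
Qed.

Lemma lev1_adj x a : vertices X x -> vertices X a -> lev x a = 1 -> e x a.
Proof.
move=> xV aV l; have [+ _] := levE xV aV; rewrite l => /dist_near[xa|//].
by move: l; rewrite xa levxx.
Qed.

(** This is condition (E), stated for all positive levels: at level 1 the
    vertex x itself is the common neighbour. *)
Lemma triangle_condition x a b n : vertices X x -> e a b ->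
  lev x a = n.+1 -> lev x b = n.+1 ->
  exists z, [/\ e z a, e z b & lev x z = n].
Proof.
move=> xV ab la lb; have [aV bV] := (adj_vl ab, adj_vr ab).
case: n la lb => [|n] la lb.
  exists x; rewrite levxx; split=> //.
    exact: lev1_adj.
  exact: lev1_adj.
case: Xws => _ _ /(_ x n.+1 xV isT)[+ _].
move=> /(_ a b (adj_neq ab)) [].
  have [_ Xab] := (adjP X a b).1 ab.
  by split=> // _ [->|->] /=; [rewrite -la|rewrite -lb]; apply: levE.
move=> t [[Xt tab Xtab] [_ tball]].
have [z tz] := simplex_neq0 Xt.
have zab : ~ [set a; b] z.
  by move=> h; have : (t `&` [set a; b]) z by []; rewrite tab.
have za : z <> a by move=> E; apply: zab; left.
have zb : z <> b by move=> E; apply: zab; right.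
have eza : e z a by apply: simplex_adj Xtab _ _ za; [left|right; left].
have ezb : e z b by apply: simplex_adj Xtab _ _ zb; [left|right; right].
exists z; split=> //; apply/eqP; rewrite eqn_leq (lev_le (tball _ tz)) /=.
by rewrite -ltnS -la; apply: lev_step => //; exact: adj_sym.
Qed.

(** This is the part of condition (V) about pairs of vertices. *)
Lemma children_near x w a b n : vertices X x -> e w a -> e w b ->
  lev x w = n.+1 -> lev x a = n -> lev x b = n -> near a b.
Proof.
move=> xV wa wb lw la lb.
have [wV [aV bV]] := (adj_vl wa, (adj_vr wa, adj_vr wb)).
case: n lw la lb => [|n] lw la lb.
  by left; rewrite -(lev0 xV aV la) -(lev0 xV bV lb).
case: Xws => _ _ /(_ x n.+1 xV isT)[_].
move=> /(_ w) [].
  by split=> // _ ->; rewrite /= -lw; apply: levE.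
move=> s Xs E.
have key c : e w c -> lev x c = n.+1 -> s c.
  move=> wc lc.
  have : (link X [set w] `&` ball X x n.+1) [set c].
    split; split.
    - exact: adj_vr wc.
    - by rewrite -subset0 => _ [->] /= /esym; exact: adj_neq wc.
    - by rewrite setUC; have [] := (adjP X w c).1 wc.
    - exact: adj_vr wc.
    - move=> _ ->; rewrite /= -lc; have [] := levE xV (adj_vr wc); done.
  by rewrite E => -[_]; apply.
have [->|ab] := pselect (a = b); first by left.
by right; apply: simplex_adj Xs (key _ _ _) (key _ _ _) ab.
Qed.

(** Seen from a, the vertices b and d are lower neighbours of c unless c is
    itself near a. *)
Lemma no_induced_square a b c d : e a b -> e b c -> e c d -> e d a ->
  near a c \/ near b d.
Proof.
move=> ab bc cd da; have [h|h] := pselect (near a c); [by left|right].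
have aV := adj_vl ab; have la := lev1 aV ab; have ld := lev1 aV (adj_sym da).
have lc : lev a c = 2.
  apply/eqP; rewrite eqn_leq; apply/andP; split.
    by rewrite -la; apply: lev_step => //; exact: adj_sym.
  rewrite ltnNge; apply/negP => l1; apply: h; apply: dist_near.
  by have [/(dist_leW l1)] := levE aV (adj_vr bc).
by apply: children_near aV (adj_sym bc) cd lc la ld.
Qed.

Section Base.
Variable x : V.
Hypothesis xV : vertices X x.

(** [desc q w] holds iff w lies on a geodesic from q to x; a descending chain
    of levels replaces the equation between the three distances. *)
Inductive desc (q : V) : V -> Prop :=
| desc_refl : desc q q
| desc_step a b : desc q a -> e a b -> lev x a = (lev x b).+1 -> desc q b.

Lemma desc_trans a b c : desc a b -> desc b c -> desc a c.
Proof. by move=> ab; elim=> [|c' d _ IH cd l] //; apply: desc_step IH cd l. Qed.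

Lemma desc1 a b : e a b -> lev x a = (lev x b).+1 -> desc a b.
Proof. by move=> ab l; apply: desc_step ab l; exact: desc_refl. Qed.

Lemma desc_lev a b : desc a b -> lev x b <= lev x a.
Proof. by elim=> // a' b' _ IH _ l; lia. Qed.

Lemma desc_eq a b : desc a b -> lev x a = lev x b -> a = b.
Proof. by case=> // a' b' /desc_lev h _ l ll; lia. Qed.

Lemma desc_exists q j : j <= lev x q -> exists2 w, desc q w & lev x w = j.
Proof.
move=> jq; move: {2}(lev x q - j) (erefl (lev x q - j)) => k.
elim: k q jq => [|k IH] q jq E.
  by exists q; [exact: desc_refl|lia].
have [n lq] : exists n, lev x q = n.+1 by exists (lev x q).-1; lia.
have [w wq lw] := lev_down lq.
have [||w' ww' lw'] := IH w; try lia.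
by exists w' => //; apply: desc_trans ww'; apply: desc1; [exact: adj_sym|lia].
Qed.

Lemma desc_parent q w : desc q w -> lev x w < lev x q ->
  exists a, [/\ desc q a, e a w & lev x a = (lev x w).+1].
Proof. by case=> [|a b qa ab l _]; [rewrite ltnn|exists a]. Qed.

Lemma desc_at q w j : desc q w -> lev x w <= j <= lev x q ->
  exists a, [/\ desc q a, desc a w & lev x a = j].
Proof.
elim=> [|a b qa IH ab l] /andP[h1 h2].
  by exists q; split; [exact: desc_refl|exact: desc_refl|lia].
have [E|ne] := eqVneq j (lev x b).
  exists b; split=> //; [exact: desc_step qa ab l|exact: desc_refl].
have [|a' [? ? ?]] := IH; first lia.
by exists a'; split=> //; apply: desc_step ab l.
Qed.

End Base.
End Levels.
(** * Wheels *)

Section Wheels.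
Variables (V : Type) (X : complex V).
Hypothesis Xsd : SD2star X 7.
Notation e := (adj X).
Notation near := (near e).

(** SD2star in terms of vertices.  It is contradicted as soon as the levels of
    two vertices of the wheel and its pendant triangle differ by 3. *)
Lemma wheel_pendant_center l v t :
  5 <= l < 7 -> wheel X l v -> e (v 1) (v 2) -> e t (v 1) -> e t (v 2) ->
  (forall i, i <= l -> t <> v i) ->
  exists u, near u t /\ forall i, i <= l -> near u (v i).
Proof.
move=> /andP[l5 l7] wv v12 tv1 tv2 tv.
have [_ fX _ /(_ l v t l5 l7 wv)] := Xsd.
have Xt := flag_triangle fX v12 (adj_sym tv1) (adj_sym tv2).
move=> [|u _ uB]; first by split.
exists u; split.
  apply: dist_near; apply: (uB [set t] _).2 => //; right.
  by split; [exists t|move=> _ ->; right].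
move=> i il; apply: dist_near; apply: (uB [set v i] _).2 => //; left; split.
  have [_ _ _ sp] := wv.
  case: i il => [|i] il; first by apply: adj_vl (sp 1 _); lia.
  by apply: adj_vr (sp i.+1 _).
by move=> _ ->; exists i.
Qed.

Lemma wheel5 c r1 r2 r3 r4 r5 :
  e r1 r2 -> e r2 r3 -> e r3 r4 -> e r4 r5 -> e r1 r5 ->
  e c r1 -> e c r2 -> e c r3 -> e c r4 -> e c r5 ->
  ~ near r1 r3 -> ~ near r1 r4 -> ~ near r2 r4 -> ~ near r2 r5 -> ~ near r3 r5 ->
  wheel X 5 (nth c [:: c; r1; r2; r3; r4; r5]).
Proof.
move=> r12 r23 r34 r45 r15 c1 c2 c3 c4 c5 n13 n14 n24 n25 n35; split=> //.
- case=> [|[|[|[|[|[|i]]]]]] [|[|[|[|[|[|j]]]]]] //= _ _ _;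
  by [apply: adj_neq; eassumption
     |move=> E; subst; match goal with h : ~ near _ _ |- _ => by apply: h; left end].
- case=> [|[|[|[|[|[|i]]]]]] [|[|[|[|[|[|j]]]]]] //= _ _ _;
  by [split=> // _; (left+right)
     |split=> [h|[|[]]] //; match goal with n : ~ near _ _ |- _ => by case: n; right end].
- by case=> [|[|[|[|[|[|i]]]]]].
Qed.

Lemma wheel6 c r1 r2 r3 r4 r5 r6 :
  e r1 r2 -> e r2 r3 -> e r3 r4 -> e r4 r5 -> e r5 r6 -> e r1 r6 ->
  e c r1 -> e c r2 -> e c r3 -> e c r4 -> e c r5 -> e c r6 ->
  ~ near r1 r3 -> ~ near r1 r4 -> ~ near r1 r5 ->
  ~ near r2 r4 -> ~ near r2 r5 -> ~ near r2 r6 ->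
  ~ near r3 r5 -> ~ near r3 r6 -> ~ near r4 r6 ->
  wheel X 6 (nth c [:: c; r1; r2; r3; r4; r5; r6]).
Proof.
move=> r12 r23 r34 r45 r56 r16 c1 c2 c3 c4 c5 c6 n13 n14 n15 n24 n25 n26 n35 n36 n46; split=> //.
- case=> [|[|[|[|[|[|[|i]]]]]]] [|[|[|[|[|[|[|j]]]]]]] //= _ _ _;
  by [apply: adj_neq; eassumption
     |move=> E; subst; match goal with h : ~ near _ _ |- _ => by apply: h; left end].
- case=> [|[|[|[|[|[|[|i]]]]]]] [|[|[|[|[|[|[|j]]]]]]] //= _ _ _;
  by [split=> // _; (left+right)
     |split=> [h|[|[]]] //; match goal with n : ~ near _ _ |- _ => by case: n; right end].
- by case=> [|[|[|[|[|[|[|i]]]]]]].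
Qed.
End Wheels.
(** * Thin bigons and contraction *)

Ltac levlia :=
  repeat match goal with
  | h : is_true (adj _ _ _) |- _ => clear h
  | h : near _ _ _ |- _ => clear h
  | h : ~ near _ _ _ |- _ => clear h
  | h : desc _ _ _ _ |- _ => clear h
  | h : walk _ _ _ _ _ |- _ => clear h
  end; lia.

Section Curvature.
Variables (V : Type) (X : complex V).
Hypotheses (Xws : weakly_systolic X) (Xsd : SD2star X 7).
Variable x : V.
Hypothesis xV : vertices X x.
Notation e := (adj X).
Notation near := (near e).
Notation l := (lev e x).
Notation desc := (desc X x).

Let lstep a b : e a b -> l a <= (l b).+1.
Proof. exact: lev_step. Qed.
Let lnear a b : near a b -> l a <= (l b).+1.
Proof. exact: lev_near. Qed.
Let nsym a b : near a b -> near b a.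
Proof. by apply: near_sym => u v; exact: adj_sym. Qed.
Let far a b : (l a).+1 < l b -> ~ near a b.
Proof. by move=> h /nsym /lnear; levlia. Qed.
Ltac not_near :=
  solve [apply: far; levlia | move=> /nsym; apply: far; levlia | move=> /nsym //].

(** Let z be a common lower neighbour of a1 and b1, and suppose that a and b are
    not near.  Then z is the centre of a wheel with rim a1, b1, b, one or two
    vertices of level n - 1, and a: a 5-wheel or a 6-wheel.  The triangle
    (a1, b1, t) is pendant, and t is at distance 3 from the bottom of the rim. *)
Lemma children_of_edge_near a1 b1 t a b n :
  e a1 b1 -> l a1 = n.+1 -> l b1 = n.+1 ->
  e t a1 -> e t b1 -> l t = n.+2 ->
  e a1 a -> e b1 b -> l a = n -> l b = n -> near a b.
Proof.
move=> ab1 la1 lb1 ta1 tb1 lt a1a b1b la lb.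
have [nab|nab] := pselect (near a b); first by [].
have [z [za1 zb1 lz]] := triangle_condition Xws xV ab1 la1 lb1.
have nza : near z a by apply: (children_near Xws xV (adj_sym za1) a1a la1 lz la).
have nzb : near z b by apply: (children_near Xws xV (adj_sym zb1) b1b lb1 lz lb).
have a1b : ~ near a1 b.
  move=> [E|h]; first by rewrite -E in lb; levlia.
  by apply: nab; apply: (children_near Xws xV a1a h la1 la lb).
have b1a : ~ near b1 a.
  move=> [E|h]; first by rewrite -E in la; levlia.
  by apply: nab; apply: (children_near Xws xV h b1b lb1 la lb).
have zae : e z a.
  by case: nza => // E; case: b1a; right; rewrite -E; exact: adj_sym.
have zbe : e z b.
  by case: nzb => // E; case: a1b; right; rewrite -E; exact: adj_sym.
case: n la1 lb1 lt la lb lz => [|n] la1 lb1 lt la lb lz.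
  by left; rewrite -(lev0 Xws xV (adj_vr a1a) la) -(lev0 Xws xV (adj_vr b1b) lb).
have [y [ya yz ly]] := triangle_condition Xws xV (adj_sym zae) la lz.
(* if one of y, y' is adjacent to both a and b, it closes a 5-wheel alone *)
have [y' [y'b y'z ly']] := triangle_condition Xws xV (adj_sym zbe) lb lz.
have nyy' : near y y'.
  by apply: (children_near Xws xV (adj_sym yz) (adj_sym y'z) lz ly ly').
have tne w : l w <= n.+2 -> t <> w by move=> h E; rewrite -E in h; levlia.
have [yb|yb] := pselect (near y b).
  have yb' : e y b by case: yb => // E; rewrite E in ly; levlia.
  have W : wheel X 5 (nth z [:: z; a1; b1; b; y; a]).
    by apply: wheel5 => //; solve [exact: adj_sym | not_near].
  have [|||||u [ut uw]] := wheel_pendant_center (t := t) Xsd _ W => //.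
    by case=> [|[|[|[|[|[|i]]]]]] //= _; apply: tne; levlia.
  by have := lnear (nsym ut); have := lnear (uw 4 isT) => /=; levlia.
have [y'a|y'a] := pselect (near y' a).
  have y'a' : e y' a by case: y'a => // E; rewrite E in ly'; levlia.
  have W : wheel X 5 (nth z [:: z; a1; b1; b; y'; a]).
    by apply: wheel5 => //; solve [exact: adj_sym | not_near].
  have [|||||u [ut uw]] := wheel_pendant_center (t := t) Xsd _ W => //.
    by case=> [|[|[|[|[|[|i]]]]]] //= _; apply: tne; levlia.
  by have := lnear (nsym ut); have := lnear (uw 4 isT) => /=; levlia.
have yy'e : e y y' by case: nyy' => // E; case: yb; right; rewrite E.
have W : wheel X 6 (nth z [:: z; a1; b1; b; y'; y; a]).
  by apply: wheel6 => //; solve [exact: adj_sym | not_near].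
have [|||||u [ut uw]] := wheel_pendant_center (t := t) Xsd _ W => //.
  by case=> [|[|[|[|[|[|[|i]]]]]]] //= _; apply: tne; levlia.
by have := lnear (nsym ut); have := lnear (uw 4 isT) => /=; levlia.
Qed.

(** Induction from q downwards.  Parents a1, b1 and grandparents a2, b2 of a and
    b are near by induction, and either a2 = b2 or the square a1, a2, b2, b1 has a
    diagonal; a2 or the upper end of the diagonal is the vertex t of
    [children_of_edge_near]. *)
Lemma bigon_thin q a b : desc q a -> desc q b -> l a = l b -> near a b.
Proof.
have [k] := ubnP (l q - l a); elim: k a b => // k IH a b lk qa qb lab.
have lqa := desc_lev qa.
have [E|ne] := eqVneq (l a) (l q).
  by left; rewrite -(desc_eq qa) ?E // -(desc_eq qb) // -E.
have [|a1 [qa1 a1a la1]] := desc_parent qa; first by levlia.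
have [|b1 [qb1 b1b lb1]] := desc_parent qb; first by levlia.
have [E|ab1] : near a1 b1 by apply: IH => //; levlia.
  by subst b1; apply: (children_near Xws xV a1a b1b la1).
have lqa1 := desc_lev qa1; have lqb1 := desc_lev qb1.
have ltq : l a1 < l q.
  rewrite ltn_neqAle lqa1 andbT; apply/eqP => E.
  by apply: (adj_neq ab1); rewrite -(desc_eq qa1) // -(desc_eq qb1) //; levlia.
have [|a2 [qa2 a2a1 la2]] := desc_parent qa1; first by levlia.
have [|b2 [qb2 b2b1 lb2]] := desc_parent qb1; first by levlia.
have nab2 : near a2 b2 by apply: IH => //; levlia.
suff [t [ta1 tb1 lt]] : exists t, [/\ e t a1, e t b1 & l t = (l a).+2].
  apply: (children_of_edge_near ab1 _ _ ta1 tb1 lt a1a b1b) => //; levlia.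
case: nab2 => [E|ab2]; first by exists a2; split; [|rewrite E|levlia].
have [h|h] := no_induced_square Xws (adj_sym a2a1) ab2 b2b1 (adj_sym ab1).
  exists b2; split=> //; last by levlia.
  by case: h => [E|/adj_sym //]; move: lb2; rewrite -E; levlia.
exists a2; split=> //; last by levlia.
by case: h => [E|//]; move: la2; rewrite E; levlia.
Qed.

Lemma near_common u v n : near u v -> n < l u -> n < l v ->
  exists p, [/\ desc u p, desc v p & l p = n].
Proof.
move=> [->|uv] nu nv.
  by have [|p vp lp] := @desc_exists V X x v n; [levlia|exists p].
have l1 := lstep uv; have l2 := lstep (adj_sym uv).
have [E|[E|E]] : l u = l v \/ (l u = (l v).+1 \/ l v = (l u).+1) by levlia.
- have [m lv] : exists m, l v = m.+1 by exists (l v).-1; levlia.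
  have [z [zu zv lz]] := triangle_condition Xws xV uv (etrans E lv) lv.
  have [|p zp lp] := @desc_exists V X x z n; first levlia.
  by exists p; split=> //; apply: desc_trans zp; (apply: desc1; [exact: adj_sym|levlia]).
- have [|p vp lp] := @desc_exists V X x v n; first levlia.
  by exists p; split=> //; apply: desc_trans vp; apply: desc1.
- have [|p up lp] := @desc_exists V X x u n; first levlia.
  exists p; split=> //; apply: desc_trans up; apply: desc1 => //; exact: adj_sym.
Qed.

(** Every edge of the walk above level n has a point of level n below both its
    ends; the points of consecutive edges are near by [bigon_thin], and there is
    one edge more than there are steps between these points. *)
Lemma walk_drop n m u w : walk e [set v | n < l v] m.+1 u w ->
  exists u' w', [/\ desc u u', desc w w' & walk e [set v | l v = n] m u' w'].
Proof.
elim: m u => [|m IH] u.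
  move=> [/= nu [v uv [nv E]]]; subst w.
  by have [p [up vp lp]] := near_common uv nu nv; exists p, p.
move=> [/= nu [v uv]]; rewrite -/(walk e _ m.+1 v w) => h.
have [v' [w' [vv' ww' h']]] := IH _ h.
have [p [up vp lp]] := near_common uv nu (walk_start h).
exists p, w'; split=> //; split=> //; exists v' => //.
by apply: bigon_thin vp vv' _; rewrite (walk_start h').
Qed.

Lemma walk_descend n m u w : walk e [set v | l v = n + m] m u w ->
  exists p, [/\ desc u p, desc w p & l p = n].
Proof.
elim: m u w => [|m IH] u w.
  by rewrite addn0 => -[/= lu <-]; exists u; split=> //; exact: desc_refl.
move=> /(walk_sub (Q := [set v | n + m < l v])) h.
have [|u' [w' [uu' ww' /IH[p [u'p w'p lp]]]]] := walk_drop (h _).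
  by move=> v /= ->; levlia.
by exists p; split=> //; [apply: desc_trans u'p|apply: desc_trans w'p].
Qed.

(** Each block of M edges shrinks to one point after M levels, and the points of
    consecutive blocks are near because they lie below a common vertex. *)
Lemma walk_contract n M k u w : walk e [set v | l v = n + M] (M * k.+1) u w ->
  exists u' w', [/\ desc u u', desc w w' & walk e [set v | l v = n] k u' w'].
Proof.
elim: k u => [|k IH] u.
  by rewrite muln1 => /walk_descend[p [up wp lp]]; exists p, p.
rewrite mulnS => /walk_split[v /walk_descend[p [up vp lp]]].
move=> /IH[v' [w' [vv' ww' h]]].
exists p, w'; split=> //; split=> //; exists v' => //.
by apply: bigon_thin vp vv' _; rewrite (walk_start h).
Qed.

Lemma desc_adj a b : desc a b -> l a = (l b).+1 -> e a b.
Proof.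
case=> [|a' b' aa' ab' l' ll]; first by levlia.
by rewrite (desc_eq aa') //; levlia.
Qed.

Lemma desc_base q : vertices X q -> desc q x.
Proof.
move=> qV; have [w qw lw] := @desc_exists V X x q 0 (leq0n _).
have wV : vertices X w by case: (qw) => [|a b _ /adj_vr].
by move: qw; rewrite -(lev0 Xws xV wV lw).
Qed.

(** * Ladders of geodesics *)

Section Ladder.
Variables q1 q2 : V.

(** The rungs of a ladder whose three sides descend towards x: one side below
    q1 only, one below q2 only, and a middle one below both.  A rung is called
    narrow when a and b are adjacent, and wide otherwise. *)
Definition rung (n : nat) (a b c : V) : Prop :=
  [/\ [/\ l a = n, l b = n & l c = n],
      desc q1 a /\ ~ desc q2 a, desc q2 b /\ ~ desc q1 b &
      desc q1 c /\ desc q2 c].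

Lemma rung_adj n a b c : rung n a b c -> e c a /\ e c b.
Proof.
move=> [[la lb lc] [qa nqa] [qb nqb] [q1c q2c]]; split.
  have [E|//] := bigon_thin q1c qa (etrans lc (esym la)).
  by case: nqa; rewrite -E.
have [E|//] := bigon_thin q2c qb (etrans lc (esym lb)).
by case: nqb; rewrite -E.
Qed.

(** The squares of consecutive rungs can only have the diagonals that go up
    from c: a descending edge from c', b' or a' to the wrong side would put a
    below q2 or b below q1.  For the same reason two consecutive rungs cannot
    both have a adjacent to b. *)
Lemma rung_diagonals n a b c a' b' c' :
  rung n a b c -> rung n.+1 a' b' c' -> e a' a -> e b' b -> e c' c ->
  [/\ e c a', e c b' & ~ (e a b /\ e a' b')].
Proof.
move=> r r' aa bb cc; have [ca cb] := rung_adj r; have [ca' cb'] := rung_adj r'.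
have [[la lb lc] [qa nqa] [qb nqb] [q1c q2c]] := r.
have [[la' lb' lc'] [qa' nqa'] [qb' nqb'] [q1c' q2c']] := r'.
have below s t : l s = n.+1 -> l t = n -> near s t -> e s t.
  by move=> ls lt [E|//]; move: ls; rewrite E lt; levlia.
split.
- have [|h] := no_induced_square Xws ca (adj_sym aa) (adj_sym ca') cc.
    by move=> /nsym/(below _ _ la' lc)/adj_sym.
  by case: nqa; apply: desc_step q2c' (below _ _ lc' la (nsym h)) _; levlia.
- have [|h] := no_induced_square Xws cb (adj_sym bb) (adj_sym cb') cc.
    by move=> /nsym/(below _ _ lb' lc)/adj_sym.
  by case: nqb; apply: desc_step q1c' (below _ _ lc' lb (nsym h)) _; levlia.
- move=> [ab ab']; have [h|h] := no_induced_square Xws ab (adj_sym bb) (adj_sym ab') aa.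
    by case: nqa; apply: desc_step qb' (below _ _ lb' la (nsym h)) _; levlia.
  by case: nqb; apply: desc_step qa' (below _ _ la' lb (nsym h)) _; levlia.
Qed.

(** Otherwise c is the centre of a 6-wheel with rim a', c', b', b, c0, a.  Its
    pendant triangle (a', c', a2) reaches level n + 2, at distance 3 from c0. *)
Lemma rungs_not_both_wide n c0 a b c a' b' c' a2 b2 c2 :
  rung n a b c -> rung n.+1 a' b' c' -> rung n.+2 a2 b2 c2 ->
  e a' a -> e b' b -> e c' c -> e a2 a' -> e b2 b' -> e c2 c' ->
  e c c0 -> e c0 a -> e c0 b -> (l c0).+1 = n ->
  near a b \/ near a' b'.
Proof.
move=> r r' r2 aa bb cc aa2 bb2 cc2 c0c c0a c0b lc0.
have [ca' cb' _] := rung_diagonals r r' aa bb cc.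
have [ca2 _ _] := rung_diagonals r' r2 aa2 bb2 cc2.
have [ca cb] := rung_adj r; have [c'a' c'b'] := rung_adj r'.
have [[la lb lc] [qa nqa] [qb nqb] [q1c q2c]] := r.
have [[la' lb' lc'] [qa' nqa'] [qb' nqb'] [q1c' q2c']] := r'.
have [[la2 _ lc2] _ _ _] := r2.
have [h|nab] := pselect (near a b); [by left|right].
have [//|nab'] := pselect (near a' b').
have b'a : ~ near b' a.
  move=> [E|h]; first by rewrite E in lb'; levlia.
  by apply: nqa; apply: desc_step qb' h _; levlia.
have a'b : ~ near a' b.
  move=> [E|h]; first by rewrite E in la'; levlia.
  by apply: nqb; apply: desc_step qa' h _; levlia.
have c'a : ~ near c' a.
  move=> [E|h]; first by rewrite E in lc'; levlia.
  by apply: nqa; apply: desc_step q2c' h _; levlia.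
have c'b : ~ near c' b.
  move=> [E|h]; first by rewrite E in lc'; levlia.
  by apply: nqb; apply: desc_step q1c' h _; levlia.
have W : wheel X 6 (nth c [:: c; a'; c'; b'; b; c0; a]).
  by apply: wheel6 => //; solve [exact: adj_sym | not_near].
have [|||||u [ut uw]] := wheel_pendant_center (t := a2) Xsd _ W => //.
- exact: adj_sym.
- exact: adj_sym.
- by case=> [|[|[|[|[|[|[|i]]]]]]] //= _ E; rewrite E in la2; levlia.
by have := lnear (nsym ut); have := lnear (uw 5 isT) => /=; levlia.
Qed.

(** Otherwise c is the centre of a 5-wheel with rim a, c0, b, b', a' and pendant
    triangle (a, c0, a0).  The vertex u near all of it has the level of c; being
    below b' it is below q2, and then so is a0, against the definition of a
    rung. *)
Lemma narrow_rung_below n a0 b0 c0 a b c a' b' c' :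
  rung n a0 b0 c0 -> rung n.+1 a b c -> rung n.+2 a' b' c' ->
  e a a0 -> e b b0 -> e c c0 -> e a' a -> e b' b -> e c' c ->
  e a' b' -> near a b.
Proof.
move=> r0 r r' aa0 bb0 cc0 aa bb cc ab'.
have [c0a c0b _] := rung_diagonals r0 r aa0 bb0 cc0.
have [ca' cb' _] := rung_diagonals r r' aa bb cc.
have [ca cb] := rung_adj r; have [c0a0 _] := rung_adj r0.
have [[la lb lc] [qa nqa] [qb nqb] [q1c q2c]] := r.
have [[la' lb' lc'] [qa' nqa'] [qb' nqb'] _] := r'.
have [[la0 lb0 lc0] [_ nqa0] _ _] := r0.
have [//|nab] := pselect (near a b).
have b'a : ~ near b' a.
  move=> [E|h]; first by rewrite E in lb'; levlia.
  by apply: nqa; apply: desc_step qb' h _; levlia.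
have a'b : ~ near a' b.
  move=> [E|h]; first by rewrite E in la'; levlia.
  by apply: nqb; apply: desc_step qa' h _; levlia.
have W : wheel X 5 (nth c [:: c; a; c0; b; b'; a']).
  by apply: wheel5 => //; solve [exact: adj_sym | not_near].
have [|||||u [ut uw]] := wheel_pendant_center (t := a0) Xsd _ W => //.
- exact: adj_sym.
- exact: adj_sym.
- exact: adj_sym.
- case=> [|[|[|[|[|[|i]]]]]] //= _ E; try (by rewrite E in la0; levlia).
  by apply: (adj_neq c0a0).
have ub' := uw 4 isT; have ua' := uw 5 isT; rewrite /= in ub' ua'.
have lu : l u = n.+1 by have := lnear ut; have := lnear (nsym ua'); levlia.
case: nqa0; apply: (@desc_step _ _ _ _ u); last by levlia.
  case: ub' => [E|h]; first by rewrite -E in lb'; levlia.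
  by apply: desc_step qb' (adj_sym h) _; levlia.
by case: ut => // E; rewrite -E in la0; levlia.
Qed.

(** If u and v are not near, then no vertex above u is below q2 and no vertex
    above v is below q1, by [bigon_thin], so that geodesics through u, v and p
    form rungs at the levels 1 to 5.  Rung 1 is wide, so rung 2 is narrow, rung
    3 is wide and rung 4 is narrow; the last two contradict
    [narrow_rung_below]. *)
Lemma first_steps_near u v p :
  desc q1 u -> desc q2 v -> l u = 1 -> l v = 1 ->
  desc q1 p -> desc q2 p -> l p = 5 -> near u v.
Proof.
move=> qu qv lu lv q1p q2p lp.
have [//|nuv] := pselect (near u v).
have px : desc p x by have [w wp _] := lev_down lp; apply: desc_base (adj_vr wp).
have lx : l x = 0 := levxx X x.
have l1 := desc_lev q1p; have l2 := desc_lev q2p.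
have chain q w : desc q w -> 5 <= l q -> l w = 1 -> exists a5 a4 a3 a2,
    [/\ [/\ desc q a5, desc a5 a4, desc a4 a3, desc a3 a2 & desc a2 w],
        [/\ e a5 a4, e a4 a3, e a3 a2 & e a2 w] &
        [/\ l a5 = 5, l a4 = 4, l a3 = 3 & l a2 = 2]].
  move=> qw lq lw.
  have [|a5 [qa5 wa5 la5]] := @desc_at V X x q w 5 qw; first by levlia.
  have [|a4 [qa4 wa4 la4]] := @desc_at V X x a5 w 4 wa5; first by levlia.
  have [|a3 [qa3 wa3 la3]] := @desc_at V X x a4 w 3 wa4; first by levlia.
  have [|a2 [qa2 wa2 la2]] := @desc_at V X x a3 w 2 wa3; first by levlia.
  exists a5, a4, a3, a2; split=> //; split; apply: desc_adj => //; levlia.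
have [|p1 [pp1 p1x lp1]] := @desc_at V X x p x 1 px; first by levlia.
have e1x := desc_adj p1x (etrans lp1 (congr1 succn (esym lx))).
have [|//|c5 [c4 [c3 [c2 [[c65 c54 c43 c32 c21] [ec4 ec3 ec2 ec1]
  [lc5 lc4 lc3 lc2]]]]]] := chain p p1 pp1; first by levlia.
have [|//|a5 [a4 [a3 [a2 [[a65 a54 a43 a32 a21] [ea4 ea3 ea2 ea1]
  [la5 la4 la3 la2]]]]]] := chain q1 u qu; first by levlia.
have [|//|b5 [b4 [b3 [b2 [[b65 b54 b43 b32 b21] [eb4 eb3 eb2 eb1]
  [lb5 lb4 lb3 lb2]]]]]] := chain q2 v qv; first by levlia.
have a64 := desc_trans a65 a54; have a63 := desc_trans a64 a43.
have a62 := desc_trans a63 a32.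
have a31 := desc_trans a32 a21; have a41 := desc_trans a43 a31.
have a51 := desc_trans a54 a41.
have b64 := desc_trans b65 b54; have b63 := desc_trans b64 b43.
have b62 := desc_trans b63 b32.
have b31 := desc_trans b32 b21; have b41 := desc_trans b43 b31.
have b51 := desc_trans b54 b41.
have c64 := desc_trans c65 c54; have c63 := desc_trans c64 c43.
have c62 := desc_trans c63 c32.
have na a : desc a u -> ~ desc q2 a.
  by move=> au qa; apply: nuv; apply: bigon_thin (desc_trans qa au) qv _; rewrite lu lv.
have nb b : desc b v -> ~ desc q1 b.
  by move=> bv qb; apply: nuv; apply: bigon_thin qu (desc_trans qb bv) _; rewrite lu lv.
have r1 : rung 1 u v p1.
  by do !split=> //; do ?[by apply: na; exact: desc_refl
    |by apply: nb; exact: desc_refl|by apply: desc_trans pp1].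
have r n a b c : desc p c -> desc q1 a -> desc a u -> desc q2 b -> desc b v ->
    l a = n -> l b = n -> l c = n -> rung n a b c.
  move=> pc qa au qb bv la lb lc; do !split=> //; do ?[exact: na|exact: nb]; exact: desc_trans pc.
have r2 : rung 2 a2 b2 c2 by apply: r.
have r3 : rung 3 a3 b3 c3 by apply: r.
have r4 : rung 4 a4 b4 c4 by apply: r.
have r5 : rung 5 a5 b5 c5 by apply: r.
have rung_edge n a b c : rung n a b c -> near a b -> e a b.
  by move=> [_ [qa nqa] [qb nqb] _] [E|//]; case: nqa; rewrite E.
have [//|n2] : near u v \/ near a2 b2.
  apply: (rungs_not_both_wide r1 r2 r3) e1x _ _ _ => //; rewrite ?lx //.
    by apply: lev1_adj => //; exact: adj_vr ea1.
  by apply: lev1_adj => //; exact: adj_vr eb1.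
have n3 : ~ near a3 b3.
  move=> n3; have [_ _] := rung_diagonals r2 r3 ea2 eb2 ec2.
  by apply; split; [exact: rung_edge r2 n2|exact: rung_edge r3 n3].
have [//|n4] : near a3 b3 \/ near a4 b4.
  have [c2a3 c2b3 _] := rung_diagonals r2 r3 ea2 eb2 ec2.
  by apply: (rungs_not_both_wide r3 r4 r5 _ _ _ _ _ _ ec2) => //; rewrite lc2.
case: n3; apply: (narrow_rung_below r2 r3 r4) => //; exact: rung_edge r4 n4.
Qed.
End Ladder.
End Curvature.
(** * Convex subcomplexes *)

Section Convexity.
Variables (V : Type) (X : complex V).
Hypothesis Xws : weakly_systolic X.
Notation e := (adj X).
Notation near := (near e).
Notation lev := (lev e).
Notation desc := (desc X).

Lemma desc_head x q w : desc x q w ->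
  q = w \/ exists2 a, e q a /\ lev x q = (lev x a).+1 & desc x a w.
Proof.
elim=> [|a b _ IH ab l]; first by left.
right; case: IH => [->|[c qc ca]]; first by exists b => //; exact: desc_refl.
by exists c => //; exact: desc_step ca ab l.
Qed.

Lemma lev_walk x P k v q : vertices X x -> walk e P k v q -> lev x q <= lev x v + k.
Proof.
move=> xV; elim: k v => [|k IH] v; first by move=> [_ ->]; lia.
move=> [_ [w vw]]; rewrite -/(walk e P k w q) => /IH.
have := lev_near Xws xV (near_sym (@adj_sym _ X) vw); lia.
Qed.

Lemma dist_desc x k w q : vertices X x ->
  dist_le e k w q -> lev x q = lev x w + k -> desc x q w.
Proof.
move=> xV /dist_walk; elim: k w => [|k IH] w.
  by move=> [_ ->] _; exact: desc_refl.
move=> [_ [v wv]]; rewrite -/(walk e _ k v q) => h l.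
have lq := lev_walk xV h.
case: wv => [E|wv]; first by rewrite -E in lq; levlia.
have lv := lev_step Xws xV (adj_sym wv).
by apply: desc_step (IH v h _) (adj_sym wv) _; levlia.
Qed.

Definition intervals_in (Y : set V) : Prop :=
  forall x q w, Y x -> Y q -> desc x q w -> Y w.

Section Local.
Variable Y : set V.
Hypothesis Ylocal : forall z a b, Y a -> Y b -> e z a -> e z b -> ~ near a b -> Y z.
Variable x : V.
Hypothesis xV : vertices X x.

(** A lower neighbour c of b other than a is adjacent to a, and a and c have a
    common lower neighbour z, which lies in Y.  As c is adjacent to z and to b,
    two vertices of Y two levels apart, it lies in Y; induction on the level
    applies to c above z. *)
Lemma desc_closed_up a b : Y b -> e b a -> lev x b = (lev x a).+1 ->
  (forall w, desc x a w -> Y w) -> forall w, desc x b w -> Y w.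
Proof.
move: {2}(lev x a) (erefl (lev x a)) => n.
elim: n a b => [|n IH] a b la Yb ba lb Ya w /desc_head[<- //|[c [bc lc] cw]].
  suff ac : a = c by apply: Ya; rewrite ac.
  rewrite -(lev0 Xws xV (adj_vr ba) la) -(lev0 Xws xV (adj_vr bc)) //; lia.
have lc' : lev x c = n.+1 by lia.
have [E|ac] : near a c by apply: (children_near Xws xV ba bc lb); lia.
  by apply: Ya; rewrite E.
have [z [za zc lz]] := triangle_condition Xws xV ac la lc'.
have az : desc x a z by apply: desc1; [exact: adj_sym|lia].
have Yc : Y c.
  apply: (Ylocal (Ya _ az) Yb (adj_sym zc) (adj_sym bc)).
  move=> h; have hb : near b z by apply: near_sym h => ? ?; exact: adj_sym.
  by have := lev_near Xws xV hb; lia.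
apply: (IH z c lz Yc (adj_sym zc)) cw; first by lia.
by move=> w' /(desc_trans az)/Ya.
Qed.

(** Follow the walk from x: when a step p, q stays in its level, a common lower
    neighbour z of p and q reduces it to a step up from z. *)
Lemma walk_desc_closed n q : walk e Y n x q -> forall w, desc x q w -> Y w.
Proof.
elim: n q => [|n IH] q.
  move=> [Yx <-] w xw; have := desc_lev xw; rewrite levxx leqn0 => /eqP lw.
  by rewrite -(desc_eq xw) // levxx lw.
rewrite -addn1 => /walk_split[p /IH Yp [_ [r pq [Yq E]]]].
rewrite {r}E in pq Yq.
move=> w qw; have [E|{}pq] := pq; first by apply: Yp; rewrite E.
have l1 := lev_step Xws xV pq; have l2 := lev_step Xws xV (adj_sym pq).
have [E|[E|E]] : lev x p = (lev x q).+1 \/ lev x p = lev x q \/ lev x q = (lev x p).+1 by lia.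
- by apply: Yp; apply: desc_trans qw; exact: desc1.
- have pV := adj_vl pq; have qV := adj_vr pq.
  have [lp|lp] := eqVneq (lev x p) 0.
    by case: (adj_neq pq); rewrite -(lev0 Xws xV pV lp) -(lev0 Xws xV qV) // -E.
  have {lp} [m lp] : exists m, lev x p = m.+1 by exists (lev x p).-1; lia.
  have lq : lev x q = m.+1 by rewrite -E lp.
  have [z [zp zq lz]] := triangle_condition Xws xV pq lp lq.
  apply: (desc_closed_up Yq (adj_sym zq)) qw; first by lia.
  by move=> w' zw; apply: Yp; apply: desc_trans zw; apply: desc1; [exact: adj_sym|lia].
- by apply: (desc_closed_up Yq (adj_sym pq) E) qw; exact: Yp.
Qed.
End Local.

Lemma induced_finite (Y s : set V) : X s /\ s `<=` Y -> finite_set s.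
Proof. by move=> [/simplex_finite]. Qed.
Lemma induced_neq0 (Y s : set V) : X s /\ s `<=` Y -> s !=set0.
Proof. by move=> [/simplex_neq0]. Qed.
Lemma induced_face (Y s t : set V) :
  X s /\ s `<=` Y -> t `<=` s -> t !=set0 -> X t /\ t `<=` Y.
Proof. by move=> [Xs sY] ts t0; split; [exact: simplex_face Xs ts t0|exact: subset_trans sY]. Qed.

Definition induced (Y : set V) : complex V :=
  Complex (@induced_finite Y) (@induced_neq0 Y) (@induced_face Y).

Section Induced.
Variable Y : set V.
Hypothesis YX : Y `<=` vertices X.
Hypothesis Yint : intervals_in Y.
Notation XY := (induced Y).

Lemma induced_vertices v : vertices XY v <-> Y v.
Proof. by split=> [[_]|Yv]; [apply|split=> [|_ -> //]; exact: YX]. Qed.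

Lemma induced_adj a b : adj XY a b <-> [/\ e a b, Y a & Y b].
Proof.
rewrite !adjP; split=> [[ab [Xab sY]]|[/adjP[ab Xab] Ya Yb]].
  by split; [apply/adjP|apply: sY; left|apply: sY; right].
by split=> //; split=> // _ [] ->.
Qed.

(** Descending from b to a stays in Y, so geodesics are paths of the
    subcomplex. *)
Lemma induced_dist n a b : Y a -> Y b ->
  dist_le (adj XY) n a b <-> dist_le e n a b.
Proof.
move=> Ya Yb; split.
  move=> /dist_walk h; apply: (@walk_dist _ _ setT); elim: n a Ya h => [//|n IH] a Ya.
  move=> [_ [c [<-|/induced_adj[ac _ Yc]] h]]; split=> //.
    by exists a; [left|exact: IH].
  by exists c; [right|exact: IH].
move=> h; have l := lev_le h.
apply: (dist_leW l); apply: dist_sym => [u v /adj_sym //|].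
have [k E] : exists k, lev a b = k by exists (lev a b).
rewrite E {h l}; elim: k b Yb E => [|k IH] b Yb lb.
  by rewrite (lev0 Xws (YX Ya) (YX Yb) lb); exact: dist_refl.
have [w wb lw] := lev_down lb.
have Yw : Y w by apply: Yint Ya Yb _; apply: desc1; [exact: adj_sym|lia].
rewrite -add1n; apply: dist_trans (IH _ Yw lw).
by apply: near_dist; right; apply/induced_adj; split=> //; exact: adj_sym.
Qed.

Lemma induced_dist_eq n a b : Y a -> Y b ->
  dist_eq (adj XY) n a b <-> dist_eq e n a b.
Proof.
move=> Ya Yb; split=> -[h1 h2]; split=> [|m hm].
- exact/induced_dist.
- by apply: h2; exact/induced_dist.
- exact/induced_dist.
- by apply: h2; exact/(induced_dist _ Ya Yb).
Qed.

Lemma induced_connected : Y !=set0 -> connected_complex XY.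
Proof.
move=> [y Yy]; split; first by exists y; apply/induced_vertices.
move=> u v /induced_vertices Yu /induced_vertices Yv.
have [n h] := vertex_dist Xws (YX Yu) (YX Yv).
by exists n; apply/induced_dist.
Qed.

Lemma induced_flag : flag XY.
Proof.
have [_ fX _] := Xws => A Afin A0 AY Aadj.
have AY' : A `<=` Y by move=> a /AY/induced_vertices.
split=> //; apply: fX => // [a /AY'/YX //|u v Au Av uv].
by have /induced_adj[] := Aadj u v Au Av uv.
Qed.

Lemma induced_convex : Y !=set0 -> convex_subcomplex X XY.
Proof.
move=> Y0; split; [split| exact: induced_connected|].
- by move=> s [].
- move=> A AY [s Xs As].
  have [A0|/set0P A0] := eqVneq A set0.
    have [y Yy] := Y0; exists [set y]; first exact/induced_vertices.
    by rewrite A0.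
  exists A => //; split; first exact: simplex_face Xs As A0.
  by move=> a /AY/induced_vertices.
- move=> x p [px dp] /induced_vertices Yx /induced_vertices Yl i ip.
  apply/induced_vertices; apply: (Yint Yx Yl).
  have xV := YX Yx; have lp := lev_eq dp.
  have E : nth x (x :: p) i = last x (take i p).
    elim: p i x ip {px dp Yl lp xV Yx} => [|y p IH] [|i] x //= ip.
    by rewrite -(IH i y ip); exact: set_nth_default.
  move: px; rewrite -{1}(cat_take_drop i p) cat_path -E => /andP[p1 p2].
  set w := nth x (x :: p) i in E p2 *.
  have h1 : dist_le e i x w.
    by exists (take i p); split=> //; rewrite size_take; case: ltnP => // /leqW.
  have h2 : dist_le e (size p - i) w (last x p).
    exists (drop i p); split=> //; last by rewrite size_drop.
    by rewrite E -last_cat cat_take_drop.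
  apply: (dist_desc xV h2).
  have := lev_le h1; have := lev_walk xV (dist_walk h2); lia.
Qed.

Lemma induced_weakly_systolic : Y !=set0 -> weakly_systolic XY.
Proof.
move=> Y0; split; [exact: induced_connected|exact: @induced_flag|].
have [_ fX XEV] := Xws.
move=> v i /induced_vertices Yv i1; have vV := YX Yv; split.
- move=> a b ab [[Xab abY] Sab].
  have Ya : Y a by apply: abY; left.
  have Yb : Y b by apply: abY; right.
  have la : lev v a = i.+1.
    by apply: lev_eq; apply/(induced_dist_eq _ Yv Ya); apply: Sab; left.
  have lb : lev v b = i.+1.
    by apply: lev_eq; apply/(induced_dist_eq _ Yv Yb); apply: Sab; right.
  have eab : e a b by apply/adjP.
  have [z [za zb lz]] := triangle_condition Xws vV eab la lb.
  have Yz : Y z.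
    by apply: (Yint Yv Ya); apply: desc1; [exact: adj_sym|lia].
  have zV := YX Yz; exists [set z]; split; split.
  + exact/induced_vertices.
  + rewrite -subset0 => _ [->] /= [E|E].
      by have := adj_neq za; rewrite E.
    by have := adj_neq zb; rewrite E.
  + split; last by move=> _ [->|[->|->]].
    have -> : [set z] `|` [set a; b] = [set z; a; b] by rewrite setUA.
    exact: flag_triangle.
  + exact/induced_vertices.
  + move=> _ ->; apply/(induced_dist _ Yv Yz).
    by have [] := levE Xws vV zV; rewrite lz.
- move=> w [[Xw wY] Sw].
  have Yw : Y w by apply: wY.
  have dw : dist_eq e i.+1 v w by apply/(induced_dist_eq _ Yv Yw); apply: Sw.
  have [|s Xs E] := (XEV v i vV i1).2 w; first by split=> // _ ->.
  have sY : s `<=` Y.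
    move=> c sc; have : faces s [set c] by split; [exists c|move=> _ ->].
    rewrite -E => -[[Xc cw Xcw] [_ /(_ c erefl) dc]].
    have wc : e w c.
      apply: simplex_adj Xcw _ _ _; [by right|by left|] => wc.
      by have : ([set c] `&` [set w]) c by []; rewrite cw.
    have lw := lev_eq dw; have lc := lev_le dc.
    have := lev_step Xws vV wc; rewrite lw => lc'.
    by apply: (Yint Yv Yw); apply: desc1 => //; lia.
  exists s => //; apply/seteqP; split=> t.
    move=> [[[Xt tY] tw [Xtw _]] [_ tB]].
    rewrite -E; split; split=> // c tc.
    by apply/(induced_dist _ Yv (tY _ tc)); exact: tB.
  move=> ft; have tY : t `<=` Y by apply: subset_trans sY; case: ft.
  move: ft; rewrite -E => -[[Xt tw Xtw] [_ tB]].
  split; split=> //.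
    by split=> // c [/tY|->].
  by move=> c tc; apply/(induced_dist _ Yv (tY _ tc)); exact: tB.
Qed.

Lemma induced_wheel k (v : nat -> V) : wheel XY k v ->
  wheel X k v /\ forall i, i <= k -> Y (v i).
Proof.
move=> [k4 inj rim spoke].
have Yv i : i <= k -> Y (v i).
  case: i => [|i] ik; first by have /induced_adj[] : adj XY (v 0) (v 1) by apply: spoke; lia.
  by have /induced_adj[] : adj XY (v 0) (v i.+1) by apply: spoke; lia.
split=> //; split=> // i.
  move=> j i1 ij jk; rewrite -(rim i j i1 ij jk) induced_adj.
  by split=> [h|[]//]; split=> //; apply: Yv; lia.
by move=> /spoke/induced_adj[].
Qed.

(** The vertex u that SD2star provides is near v_1 and v_3, which are at
    distance 2, so it lies on a geodesic between them, hence in Y. *)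
Lemma induced_SD2star : SD2star X 7 -> SD2star XY 7.
Proof.
move=> [_ fX no4 sd]; split=> //; first exact: @induced_flag.
  by move=> v /induced_wheel[/no4].
move=> l v t l5 l7 /induced_wheel[wv Yv] [[Xt tY] tv].
have [//|u uV uB] := sd l v t l5 l7 wv.
have near_u i : i <= l -> near u (v i).
  move=> il; apply: dist_near; apply: (uB [set v i] _).2 => //; left; split.
    exact: YX (Yv i il).
  by move=> _ ->; exists i.
have Yu : Y u.
  have [_ inj rim _] := wv.
  have n1 := near_u 1 (ltnW (ltnW (ltnW (ltnW l5)))).
  have n3 : near u (v 3) by apply: near_u; lia.
  have Y1 : Y (v 1) by apply: Yv; lia.
  have Y3 : Y (v 3) by apply: Yv; lia.
  have n13 : ~ near (v 1) (v 3).
    move=> [E|h]; first by apply: (inj 1 3) E; lia.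
    by have /rim : e (v 1) (v 3) by []; lia.
  have [E|e1] := n1; first by rewrite E.
  have [E|e3] := n3; first by rewrite E.
  have V1 := YX Y1.
  have l1 := lev1 Xws V1 (adj_sym e1).
  apply: (Yint Y1 Y3); apply: desc1; first exact: adj_sym.
  have := lev_step Xws V1 (adj_sym e3); rewrite l1 => le2.
  suff : 1 < lev (v 1) (v 3) by lia.
  rewrite ltnNge; apply/negP => le1; apply: n13; apply: dist_near.
  by have [h _] := levE Xws V1 (YX Y3); apply: dist_leW h.
exists u; first exact/induced_vertices.
move=> s [[[Xs sY] h]|fs].
  have [|_ sB] := uB s; first by left.
  split=> // c sc; apply/(induced_dist _ Yu (sY _ sc)); exact: sB.
have [_ sB] := uB s (or_intror fs).
have sY : s `<=` Y by case: fs => _ /subset_trans; apply.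
split; last by move=> c sc; apply/(induced_dist _ Yu (sY _ sc)); exact: sB.
by split=> //; case: fs => s0 st; apply: simplex_face Xt st s0.
Qed.

End Induced.
End Convexity.
(** * Finite sets *)

Lemma finite_set_ind (T : Type) (P : set T -> Prop) :
  P set0 -> (forall A a, finite_set A -> P A -> P (a |` A)) ->
  forall A, finite_set A -> P A.
Proof.
move=> P0 PU A /(@finite_seqP {classic T})[s ->].
elim: s => [|a s IH]; first by rewrite set_nil.
have -> : [set` a :: s] = (a : T) |` [set` s].
  apply/seteqP; split=> x /=; rewrite inE; first by move=> /orP[/eqP|]; [left|right].
  by move=> [->|xs]; rewrite ?eqxx ?xs ?orbT.
by apply: PU IH; exact: (@finite_seq {classic T}).
Qed.

Lemma finite_uniform_bound (T : Type) (A : set T) (P : nat -> T -> Prop) :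
  finite_set A -> (forall m n a, m <= n -> P m a -> P n a) ->
  (forall a, A a -> exists n, P n a) -> exists n, forall a, A a -> P n a.
Proof.
move=> Afin mono; move: A Afin; apply: finite_set_ind => [|A a _ IH] h; first by exists 0.
have [n hn] : exists n, forall a, A a -> P n a by apply: IH => b Ab; apply: h; right.
have [m hm] := h a (or_introl erefl).
exists (maxn m n) => b [->|/hn]; first by apply: mono hm; exact: leq_maxl.
by apply: mono; exact: leq_maxr.
Qed.

Lemma finite_subsets (T : Type) (A : set T) :
  finite_set A -> finite_set [set B : set T | B `<=` A].
Proof.
move: A; apply: finite_set_ind => [|A a _ IH].
  by apply: sub_finite_set (finite_set1 set0) => B /=; rewrite subset0.
apply: (@sub_finite_set _ _ ([set B | B `<=` A] `|` (setU [set a]) @` [set B | B `<=` A])).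
  move=> B BA; have [Ba|Ba] := pselect (B a).
    right; exists (B `\ a); first by move=> b [/BA[]].
    by rewrite setDUK // => _ ->.
  by left=> b Bb; case: (BA _ Bb) => // E; case: Ba; rewrite -E.
by rewrite finite_setU; split=> //; exact: finite_image.
Qed.

(** * The geometry of the orbit map *)

Section LocatedWalks.
Variables (T : Type) (e : rel T).

Lemma dist_walk_ball n u w : dist_le e n u w ->
  walk e [set v | dist_le e n u v] n u w.
Proof.
move=> /dist_walk; suff H m k v : m + k <= n -> dist_le e k u v -> walk e setT m v w ->
  walk e [set v | dist_le e n u v] m v w.
  by apply: H (dist_refl _ 0 u); rewrite addn0.
elim: m k v => [|m IH] k v mk uv.
  by move=> [_ <-]; split=> //; exact: dist_leW uv.
move=> [_ [v' vv']]; rewrite -/(walk e setT m v' w) => h.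
split; first by apply: dist_leW uv; lia.
exists v' => //; apply: (IH k.+1) => //; first by lia.
by rewrite -addn1; apply: dist_trans uv (near_dist _).
Qed.

Lemma path_walk (P : set T) x p : path e x p ->
  (forall i, i <= size p -> P (nth x (x :: p) i)) -> walk e P (size p) x (last x p).
Proof.
elim: p x => [|y p IH] x /= => [_ /(_ 0 isT) //|/andP[xy yp] h].
split; first exact: (h 0).
exists y; first by right.
apply: IH yp _ => i ip; have := h i.+1 ip.
by rewrite /= (set_nth_default y).
Qed.
End LocatedWalks.

Section Actions.
Variables (G : groupType) (V : Type) (X : complex V) (act : G -> V -> V).
Hypothesis Xws : weakly_systolic X.
Hypothesis Ggeom : geometric_action [set: G] act X.
Notation e := (adj X).
Local Open Scope group_scope.

Lemma act1 v : vertices X v -> act 1 v = v.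
Proof. by have [[h _ _] _ _] := Ggeom; apply: h. Qed.

Lemma actM g h v : vertices X v -> act (g * h) v = act g (act h v).
Proof. by have [[_ f _] _ _] := Ggeom; apply: f. Qed.

Lemma act_vertex g v : vertices X v -> vertices X (act g v).
Proof.
have [[_ _ f] _ _] := Ggeom => vV.
by have := f g [set v] Logic.I vV; rewrite image_set1.
Qed.

Lemma actKV g v : vertices X v -> act g^-1 (act g v) = v.
Proof. by move=> vV; rewrite -actM // mulVg act1. Qed.

Lemma actVK g v : vertices X v -> act g (act g^-1 v) = v.
Proof. by move=> vV; rewrite -actM // mulgV act1. Qed.

Lemma act_adj g u v : e u v -> e (act g u) (act g v).
Proof.
move=> uv; have [uV vV] := (adj_vl uv, adj_vr uv).
have [uv' Xuv] := (adjP X u v).1 uv; apply/adjP; split.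
  by move=> E; apply: uv'; rewrite -(actKV g uV) E actKV.
have [[_ _ f] _ _] := Ggeom.
by have := f g _ Logic.I Xuv; rewrite image_setU !image_set1.
Qed.

Lemma act_dist g n u v : dist_le e n u v -> dist_le e n (act g u) (act g v).
Proof.
move=> /dist_walk h; apply: (@walk_dist _ _ setT); elim: n u h => [|n IH] u.
  by move=> [_ <-].
move=> [_ [w uw]]; rewrite -/(walk e _ n w v) => /IH h; split=> //.
by exists (act g w) => //; case: uw => [->|/(act_adj g)]; [left|right].
Qed.

Lemma dist_vertex n u v : vertices X u -> dist_le e n u v -> vertices X v.
Proof.
move=> uV /dist_walk; elim: n u uV => [|n IH] u uV; first by move=> [_ <-].
move=> [_ [w uw]]; rewrite -/(walk e _ n w v); apply: IH.
by case: uw => [<-|/adj_vr].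
Qed.

Lemma orbit_representatives : exists F : set V,
  [/\ finite_set F, F `<=` vertices X &
      forall s, X s -> exists g, forall v, s v -> exists2 f, F f & v = act g f].
Proof.
have [_ _ [F [Ffin FX Fs]]] := Ggeom.
exists (\bigcup_(t in F) t); split.
- by apply: bigcup_finite => // t /FX; exact: simplex_finite.
- by move=> v [t /FX Xt tv]; exact: simplex_vertex Xt tv.
- move=> s Xs; have [g [t [_ Ft ->]]] := Fs s Xs.
  by exists g => _ [f tf <-]; exists f => //; exists t.
Qed.

(** Edges at v are translates of edges of a finite set F of representatives, and
    only finitely many elements of G map a vertex of F to v. *)
Lemma neighbours_finite v : finite_set [set w | near e v w].
Proof.
have [vV|vV] := pselect (vertices X v); last first.
  apply: sub_finite_set (finite_set1 v) => w /= [->|/adj_vl] //.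
have [F [Ffin FX Fs]] := orbit_representatives.
have [_ pd _] := Ggeom.
have Gfin := pd (v |` F) _ _; rewrite finite_setU in Gfin.
pose Gv := [set g | [set: G] g /\ (act g @` (v |` F) `&` (v |` F)) !=set0].
apply: (@sub_finite_set _ _ (v |` [set act g f | g in Gv & f in F])).
  move=> w /= [->|vw]; first by left.
  right; have [_ Xvw] := (adjP X v w).1 vw.
  have [g gF] := Fs _ Xvw.
  have [f1 Ff1 vE] := gF v (or_introl erefl).
  have [f2 Ff2 wE] := gF w (or_intror erefl).
  exists g; last by exists f2.
  by split=> //; exists v; split; [exists f1 => //; right|left].
rewrite finite_setU; split; first exact: finite_set1.
apply: finite_image2 => //; apply: Gfin; first by split=> //; exact: finite_set1.
by move=> w [->|/FX].
Qed.

Lemma ball_finite n v : finite_set [set w | dist_le e n v w].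
Proof.
elim: n => [|n IH].
  by apply: sub_finite_set (finite_set1 v) => w /= /dist_le0.
apply: (@sub_finite_set _ _ (\bigcup_(u in [set w | dist_le e n v w]) [set w | near e u w])).
  move=> w /=; rewrite -addn1 => /dist_split[u vu /dist_near uw].
  by exists u.
by apply: bigcup_finite => // u _; exact: neighbours_finite.
Qed.

Variable v0 : V.
Hypothesis v0V : vertices X v0.

Lemma orbit_cobounded : exists D, forall v, vertices X v -> exists g, dist_le e D v (act g v0).
Proof.
have [F [Ffin FX Fs]] := orbit_representatives.
have [m n a mn|a Fa|D hD] := finite_uniform_bound (P := fun n f => dist_le e n f v0) Ffin.
- exact: dist_leW.
- by apply: (vertex_dist Xws) => //; exact: FX.
- exists D => v vV; have [g gF] := Fs _ vV; have [f Ff ->] := gF v erefl.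
  by exists g; apply: act_dist; exact: hD.
Qed.

Lemma displacement_finite n : finite_set [set g | dist_le e n v0 (act g v0)].
Proof.
have [_ pd _] := Ggeom.
have ballX : [set w | dist_le e n v0 w] `<=` vertices X.
  by move=> w /=; exact: dist_vertex.
apply: sub_finite_set (pd _ (ball_finite n v0) ballX) => g /= h.
by split=> //; exists (act g v0); split=> //; exists v0 => //; exact: dist_refl.
Qed.

Section Cayley.
Variable S : set G.
Hypotheses (Sfin : finite_set S) (Sgen : generates S).
Notation c := (cayley S).

Lemma cayley_sym g h : c g h -> c h g.
Proof.
move=> /asboolP[gh [s Ss E]]; apply/asboolP; split; first by move=> /esym.
by exists s => //; case: E; [right|left].
Qed.

Lemma cayley_mull k g h : c g h -> c (k * g) (k * h).
Proof.
move=> /asboolP[gh [s Ss E]]; apply/asboolP; split; first by move=> /mulgI.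
by exists s => //; case: E => ->; [left|right]; rewrite mulgA.
Qed.

Lemma cayley_dist_mull k n g h : dist_le c n g h -> dist_le c n (k * g) (k * h).
Proof.
move=> /dist_walk hw; apply: (@walk_dist _ _ setT); elim: n g hw => [|n IH] g.
  by move=> [_ <-].
move=> [_ [w gw]]; rewrite -/(walk c _ n w h) => /IH h'; split=> //.
by exists (k * w) => //; case: gw => [->|/(cayley_mull k)]; [left|right].
Qed.

Lemma cayley_connected g : exists n, dist_le c n 1 g.
Proof.
pose M := [set g | exists n, dist_le c n 1 g].
suff : smallest (@subgroup G) S `<=` M by rewrite Sgen; apply.
apply: smallest_sub.
  split; first by rewrite in_setE; exists 0; exact: dist_refl.
  move=> u v; rewrite !in_setE => -[m um] [n vn]; exists (m + n)%N.
  apply: dist_trans um _; have := cayley_dist_mull (u * v^-1) vn.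
  by rewrite mulg1 mulgVK; apply: dist_sym => a b; exact: cayley_sym.
move=> s Ss; exists 1%N; apply: near_dist.
have [->|s1] := pselect (1 = s); first by left.
by right; apply/asboolP; split=> //; exists s => //; left; rewrite mul1g.
Qed.

Lemma orbit_map_lipschitz : exists M, forall g h, near c g h -> dist_le e M (act g v0) (act h v0).
Proof.
have [m n a mn|s _|M hM] := finite_uniform_bound (P := fun n s => dist_le e n v0 (act s v0)) Sfin.
- exact: dist_leW.
- by apply: (vertex_dist Xws) => //; exact: act_vertex.
- have esym a b : e a b -> e b a by exact: adj_sym.
  exists M => g h [->|/asboolP[_ [s Ss [->|->]]]]; first exact: dist_refl.
    by rewrite actM //; apply: act_dist; exact: hM.
  by apply: dist_sym => //; rewrite actM //; apply: act_dist; exact: hM.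
Qed.

(** Half of the Milnor-Svarc lemma: vertices of a path between orbit points are
    within D of the orbit, so that the path is followed by steps in G from a
    finite set, and these have bounded word length.  The successor in the bound
    accounts for stabilizers. *)
Lemma cayley_dist_orbit : exists L, forall n g h,
  dist_le e n (act g v0) (act h v0) -> dist_le c (L * n.+1)%N g h.
Proof.
have esym a b : e a b -> e b a by exact: adj_sym.
have [D hD] := orbit_cobounded.
have [m n a mn|s _|L hL] := finite_uniform_bound (P := fun n s => dist_le c n 1 s)
    (displacement_finite (D + 1 + D)%N).
- exact: dist_leW.
- exact: cayley_connected.
have step g h : dist_le e (D + 1 + D)%N (act g v0) (act h v0) -> dist_le c L g h.
  move=> /(act_dist g^-1); rewrite actKV // -actM // => /hL/(cayley_dist_mull g).
  by rewrite mulg1 mulVKg.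
exists L => n g h gh.
suff key w : dist_le e D w (act h v0) -> dist_le e n (act g v0) w ->
    dist_le c (L * n.+1)%N g h by apply: key gh; exact: dist_refl.
elim: n w h {gh} => [|n IH] w h wh.
  by move=> /dist_le0 E; rewrite muln1; apply: step; apply: (@dist_leW _ _ D); [lia|rewrite E].
rewrite -[n.+1]addn1 => /dist_split[w' gw' w'w].
have w'V : vertices X w' by apply: dist_vertex gw'; exact: act_vertex.
have [h' wh'] := hD _ w'V.
rewrite addn1 mulnS addnC; apply: dist_trans (IH w' h' wh' gw') _; apply: step.
by apply: dist_trans wh; apply: dist_trans w'w; exact: dist_sym.
Qed.

(** Map a Cayley geodesic from g to h to X; each of its edges becomes a walk of
    at most M steps. *)
Lemma quasiconvex_orbit H : quasiconvex c H ->
  exists K A B, forall g h n, H g -> H h -> dist_le e n (act g v0) (act h v0) ->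
    walk e [set v | exists2 k, H k & dist_le e K (act k v0) v] (A * n + B)%N
      (act g v0) (act h v0).
Proof.
have esym a b : e a b -> e b a by exact: adj_sym.
move=> [K0 _ qc]; have [M hM] := orbit_map_lipschitz; have [L hL] := cayley_dist_orbit.
have dM n g h : dist_le c n g h -> dist_le e (M * n)%N (act g v0) (act h v0).
  move=> /dist_walk; elim: n g => [|n IH] g; first by move=> [_ <-]; exact: dist_refl.
  move=> [_ [k gk]]; rewrite -/(walk c _ n k h) mulnS => /IH.
  by apply: dist_trans; exact: hM.
exists (M * K0 + M)%N, (M * L)%N, (M * L)%N => g h n Hg Hh gh.
have [[p [pg ph ps]] pmin] := levP (hL _ _ _ gh).
have ps' : size p <= (L * n.+1)%N by apply: leq_trans ps (lev_le _); exact: hL.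
have geo : geodesic c g p.
  split=> //; rewrite ph; split; first by exists p.
  move=> m /pmin; exact: leq_trans.
have w : walk c [set k | exists2 k', H k' & dist_le c K0 k k'] (size p) g h.
  rewrite -ph; apply: path_walk => // i ip; apply: (qc g p) => //; by rewrite ph.
apply: (@walk_pad _ _ _ (M * size p)%N); first by nia.
elim: (size p) g w {pg ph ps pmin ps' geo gh Hg} => [|m IH] g.
  move=> [[k Hk gk] <-]; rewrite muln0; split=> //; exists k => //.
  by apply: dist_leW (dist_sym esym (dM _ _ _ gk)); lia.
move=> [[k Hk gk] [g' gg']]; rewrite -/(walk c _ m g' h) mulnS => /IH.
apply: walk_cat; apply: walk_sub (dist_walk_ball (hM _ _ gg')) => v /= gv.
by exists k => //; apply: dist_trans gv; exact: dist_sym (dM _ _ _ gk).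
Qed.
End Cayley.
End Actions.
(** * Neighbourhoods of the orbit *)

Section OrbitNeighbourhood.
Variables (G : groupType) (V : Type) (X : complex V) (act : G -> V -> V).
Hypothesis Xws : weakly_systolic X.
Hypothesis Xsd : SD2star X 7.
Hypothesis Ggeom : geometric_action [set: G] act X.
Variable v0 : V.
Hypothesis v0V : vertices X v0.
Variable H : set G.
Notation e := (adj X).
Local Open Scope group_scope.

Definition orbit_nbhd (R : nat) : set V :=
  [set v | exists2 h, H h & dist_le e R (act h v0) v].

Lemma orbit_nbhd_vertex R : orbit_nbhd R `<=` vertices X.
Proof. by move=> v [h _]; apply: dist_vertex; exact: (act_vertex Ggeom). Qed.

(** R has three parts: K for the distance of the walk to the orbit, 5 + k for
    the end of the descent, and M for the contraction.  A walk of length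
    A * (2 * R + 2) + B must fit in k + 1 blocks of length M; as R is M plus a
    constant, k = 2 * A makes this possible, for M large. *)
Lemma orbit_nbhd_intervals S : finite_set S -> generates S ->
  quasiconvex (cayley S) H -> exists R, intervals_in X (orbit_nbhd R).
Proof.
move=> Sfin Sgen Hqc.
have esym a b : e a b -> e b a by exact: adj_sym.
have [K [A [B hKAB]]] := quasiconvex_orbit Xws Ggeom v0V Sfin Sgen Hqc.
pose M := (2 * A * (K + 6 + 2 * A) + B)%N; pose k := (2 * A)%N.
pose R := (K + (5 + k + M))%N; exists R.
have orbitV h : vertices X (act h v0) by exact: (act_vertex Ggeom).
have KR : orbit_nbhd K `<=` orbit_nbhd R.
  by move=> v [h Hh hv]; exists h => //; apply: dist_leW hv; exact: leq_addr.
have local z a b : orbit_nbhd R a -> orbit_nbhd R b -> e z a -> e z b ->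
    ~ near e a b -> orbit_nbhd R z.
  move=> [h1 H1 h1a] [h2 H2 h2b] za zb nab.
  have [//|nYz] := pselect (orbit_nbhd R z); case: nab.
  have zV := adj_vl za.
  have levq h a' : H h -> e z a' -> dist_le e R (act h v0) a' ->
      lev e z (act h v0) = R.+1 /\ desc X z (act h v0) a'.
    move=> Hh za' /(dist_sym esym) ha.
    have l : lev e z (act h v0) = R.+1.
      apply/eqP; rewrite eqn_leq; apply/andP; split.
        rewrite -add1n; apply: lev_le; apply: dist_trans ha.
        by apply: near_dist; right.
      rewrite ltnNge; apply/negP => lR; apply: nYz; exists h => //.
      apply: dist_sym => //; apply: dist_leW lR _.
      by have [] := levE Xws zV (orbitV h).
    split=> //; apply: (dist_desc Xws zV ha).
    by rewrite l (lev1 Xws zV za').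
  have [l1 d1] := levq _ _ H1 za h1a; have [l2 d2] := levq _ _ H2 zb h2b.
  have dq : dist_le e (R + (1 + 1 + R))%N (act h1 v0) (act h2 v0).
    apply: dist_trans h1a _; apply: dist_trans; last exact: (dist_sym esym h2b).
    by apply: (@dist_trans _ _ _ _ _ z); apply: near_dist; right => //; exact: esym.
  have w := hKAB _ _ _ H1 H2 dq.
  have {}w : walk e [set v | (5 + k + M)%N < lev e z v] (M * k.+1).+1
      (act h1 v0) (act h2 v0).
    apply: (walk_pad (m := (A * (R + (1 + 1 + R)) + B)%N)).
      by rewrite /R /k; have : M = (2 * A * (K + 6 + 2 * A) + B)%N by []; nia.
    apply: walk_sub w => v [h Hh hv] /=; rewrite ltnNge; apply/negP => lv.
    apply: nYz; exists h => //.
    have vV : vertices X v by apply: dist_vertex hv; exact: orbitV.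
    have [zv _] := levE Xws zV vV.
    by apply: dist_trans hv _; apply: dist_sym => //; exact: dist_leW zv.
  have [u1 [u2 [hu1 hu2 /(walk_contract Xws Xsd zV)]]] := walk_drop Xws Xsd zV w.
  move=> [w1 [w2 [hw1 hw2 /(walk_descend Xws Xsd zV)[p [hp1 hp2 lp]]]]].
  apply: (first_steps_near Xws Xsd zV d1 d2 _ _ _ _ lp).
  - exact: lev1 za.
  - exact: lev1 zb.
  - exact: desc_trans (desc_trans hu1 hw1) hp1.
  - exact: desc_trans (desc_trans hu2 hw2) hp2.
have conn x q : orbit_nbhd R x -> orbit_nbhd R q -> exists n, walk e (orbit_nbhd R) n x q.
  move=> [h1 H1 h1x] [h2 H2 h2q].
  have to h v : H h -> dist_le e R (act h v0) v -> walk e (orbit_nbhd R) R (act h v0) v.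
    by move=> Hh /dist_walk_ball; apply: walk_sub => w hw; exists h.
  have [n d] := vertex_dist Xws (orbitV h1) (orbitV h2).
  exists (R + ((A * n + B) + R))%N; apply: walk_cat (walk_rev esym (to _ _ H1 h1x)) _.
  by apply: walk_cat (to _ _ H2 h2q); apply: walk_sub KR _; exact: hKAB.
move=> x q w Yx Yq xqw; have [n xq] := conn x q Yx Yq.
exact: (walk_desc_closed Xws local (orbit_nbhd_vertex Yx) xq).
Qed.

Hypothesis Hsub : subgroup H.

Lemma subgroup1 : H 1.
Proof. by case: Hsub; rewrite in_setE. Qed.

Lemma subgroupV g : H g -> H g^-1.
Proof.
case: Hsub => _ h Hg; have := h 1 g; rewrite !in_setE mul1g; apply => //.
exact: subgroup1.
Qed.

Lemma subgroupM g h : H g -> H h -> H (g * h).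
Proof.
move=> Hg /subgroupV Hh; case: Hsub => _ /(_ g h^-1).
by rewrite !in_setE invgK; apply.
Qed.

Lemma orbit_nbhd_invariant R g v : H g -> orbit_nbhd R v -> orbit_nbhd R (act g v).
Proof.
move=> Hg [h Hh hv]; exists (g * h); first exact: subgroupM.
by rewrite (actM Ggeom) //; exact: (act_dist Ggeom).
Qed.

Lemma orbit_nbhd_invariant_subcomplex R :
  invariant_subcomplex H act (induced X (orbit_nbhd R)).
Proof.
move=> g s Hg [Xs sY]; have [[_ _ f] _ _] := Ggeom; split; first exact: f.
by move=> _ [v /sY Yv <-]; exact: orbit_nbhd_invariant.
Qed.

Lemma orbit_nbhd_geometric R : geometric_action H act (induced X (orbit_nbhd R)).
Proof.
have inX v : vertices (induced X (orbit_nbhd R)) v -> vertices X v by case.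
have esym a b : e a b -> e b a by exact: adj_sym.
split.
- split=> [v /inX|g h v _ _ /inX|g s Hg]; [exact: act1|exact: actM|].
  exact: orbit_nbhd_invariant_subcomplex.
- move=> F Ffin FY; have [_ pd _] := Ggeom.
  have FX : F `<=` vertices X by move=> v /FY/inX.
  by apply: sub_finite_set (pd F Ffin FX) => g [].
- exists [set s | (induced X (orbit_nbhd R)) s /\ s `<=` [set v | dist_le e R.+1 v0 v]].
  split.
  + apply: sub_finite_set (finite_subsets (ball_finite Ggeom R.+1 v0)).
    by move=> s [].
  + by move=> s [].
  + move=> s [Xs sY]; have [w sw] := simplex_neq0 Xs; have [h Hh hw] := sY w sw.
    exists h, (act h^-1 @` s).
    have Ys : (induced X (orbit_nbhd R)) s by [].
    have sV v : s v -> vertices X v by move=> sv; exact: simplex_vertex Xs sv.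
    split=> //; last first.
      apply/seteqP; split=> v /=.
        move=> sv; exists (act h^-1 v); first by exists v.
        by apply: (actVK Ggeom); exact: sV.
      by move=> [_ [u su <-] <-]; rewrite (actVK Ggeom) //; exact: sV.
    split; first exact: orbit_nbhd_invariant_subcomplex (subgroupV Hh) Ys.
    move=> _ [v sv <-] /=; rewrite -{1}(actKV Ggeom h v0V); apply: (act_dist Ggeom).
    rewrite -addn1; apply: dist_trans hw _; apply: near_dist.
    have [->|wv] := pselect (w = v); first by left.
    by right; exact: simplex_adj Xs sw sv wv.
Qed.
End OrbitNeighbourhood.

Theorem corollary7p17 (G : groupType) (V : Type) (X : complex V)
    (act : G -> V -> V)
    (Xws : weakly_systolic X) (Xsd : SD2star X 7)
    (Ggeom : geometric_action [set: G] act X)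
    (H : set G) (Hqc : quasiconvex_subgroup H) :
  convex_cocompact H act X /\
  exists (W : Type) (Z : complex W) (actZ : G -> W -> W),
    [/\ geometric_action H actZ Z, weakly_systolic Z & SD2star Z 7].
Proof.
have [Hsub [S [Sfin Sgen Sqc]]] := Hqc.
have [[[v0 v0V] _] _ _] := Xws.
have [R Rint] := orbit_nbhd_intervals Xws Xsd Ggeom v0V Sfin Sgen Sqc.
pose Y := orbit_nbhd X act v0 H R.
have YX : Y `<=` vertices X by move=> v; exact: (orbit_nbhd_vertex Ggeom v0V).
have Y0 : Y !=set0.
  exists v0; exists 1%g; first exact: subgroup1.
  by rewrite (act1 Ggeom) //; exact: dist_refl.
have geo : geometric_action H act (induced X Y).
  exact: (orbit_nbhd_geometric Ggeom v0V Hsub).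
split.
  exists (induced X Y); split=> //; first exact: induced_convex.
  by move=> g s; exact: (orbit_nbhd_invariant_subcomplex Ggeom v0V Hsub).
exists V, (induced X Y), act; split=> //; first exact: induced_weakly_systolic.
exact: induced_SD2star.
Qed.
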